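(* Let $q\ge1$, let $n_1,\dots,n_{2q}$ be distinct nonzero integers, and let $x_n=1/\lambda_n$, where $\{\lambda_n\}_{n\in\mathbb Z}$ are the eigenvalues of the Dirac boundary value problem described in the context. Let $\Lambda_0$ be the $2q\times2q$ matrix whose $s$-th row is $$K_0\bigl((-1)^{n_s},\ (-1)^{n_s}x_{n_s},\ \dots,\ (-1)^{n_s}x_{n_s}^{q-1},\ -1,\ -x_{n_s},\ \dots,\ -x_{n_s}^{q-1}\bigr),\qquad K_0=\tfrac1{\sqrt2}.$$ Let $q_e$ be the number of $s\in\{1,\dots,2q\}$ with $n_s$ even and $q_o$ the number of $s$ with $n_s$ odd. Then $\Lambda_0$ is nonsingular if and only if $q_e=q_o=q$.
   Context: Dirac problem. Let $p,r\in C^q[-1,1]$ be real-valued and $\alpha,\beta\in[0,\pi]$. The eigenvalue problem is $$\begin{pmatrix}0&1\\-1&0\end{pmatrix}y'-\begin{pmatrix}p(x)&0\\0&r(x)\end{pmatrix}y=\lambda y\quad\text{on }[-1,1],$$ with boundary conditions $y_2(-1)\cos\alpha+y_1(-1)\sin\alpha=0$, $y_2(1)\cos\beta+y_1(1)\sin\beta=0$. It is assumed that $\lambda=0$ is not an eigenvalue. The eigenvalues $\{\lambda_n\}_{n\in\mathbb Z}$ (pairwise distinct) are indexed in increasing order with the origin of the indexing chosen so that $\lambda_n=\frac{\pi n}{2}-\frac{\widetilde\theta}{2}+O(1/n)$ as $n\to\pm\infty$, where $\widetilde\theta=\beta-\alpha+\frac12\int_{-1}^1(p+r)\,d\tau$.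 *)

(* Defs.v *)
From mathcomp Require Import all_boot all_order all_algebra.
From mathcomp Require Import all_classical all_reals all_analysis.
From mathcomp Require Import complex.
Set Implicit Arguments.
Unset Strict Implicit.
Unset Printing Implicit Defensive.

Import Order.TTheory GRing.Theory Num.Theory.
Import numFieldNormedType.Exports.
Local Open Scope classical_set_scope.
Local Open Scope ring_scope.
Local Open Scope complex_scope.

(* The derivative relative to [-1, 1]: it is the usual derivative at interior
   points and the one-sided derivative at -1 and 1. *)
Definition is_derivative_at {R : realType} (f : R -> R) (x l : R) : Prop :=
  (f t - f x) / (t - x) @[t --> within (`[-1, 1] `\ x) (nbhs x)] --> l.

(* f is of class C^k on [-1, 1]; only the values of f on [-1, 1] matter. *)
Fixpoint class_C {R : realType} (k : nat) (f : R -> R) : Prop :=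
  if k is k'.+1 then
    exists2 g : R -> R,
      (forall x : R, x \in `[-1, 1] -> is_derivative_at f x (g x)) & class_C k' g
  else {within `[-1, 1], continuous f}.

Definition is_cderivative_at {R : realType} (f : R -> R[i]) (x : R) (l : R[i])
    : Prop :=
  is_derivative_at (fun t => complex.Re (f t)) x (complex.Re l) /\
  is_derivative_at (fun t => complex.Im (f t)) x (complex.Im l).

Definition dirac_system {R : realType} (p r : R -> R) (lambda : R[i])
    (y1 y2 : R -> R[i]) : Prop :=
  forall x : R, x \in `[-1, 1] -> exists d1 d2 : R[i],
    [/\ is_cderivative_at y1 x d1,
        is_cderivative_at y2 x d2,
        d2 - (p x)%:C * y1 x = lambda * y1 x &
        - d1 - (r x)%:C * y2 x = lambda * y2 x].

(* Eigenvalues are a priori complex. *)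
Definition dirac_eigenvalue {R : realType} (p r : R -> R) (alpha beta : R)
    (lambda : R[i]) : Prop :=
  exists y1 y2 : R -> R[i],
    [/\ dirac_system p r lambda y1 y2,
        y2 (-1) * (cos alpha)%:C + y1 (-1) * (sin alpha)%:C = 0,
        y2 1 * (cos beta)%:C + y1 1 * (sin beta)%:C = 0 &
        exists2 x : R, x \in `[-1, 1] & (y1 x, y2 x) <> (0, 0)].

Definition dirac_theta {R : realType} (p r : R -> R) (alpha beta : R) : R :=
  beta - alpha
  + 2^-1 * \int[lebesgue_measure]_(t in `[-1, 1]) (p t + r t).

Definition dirac_asymptotics {R : realType} (theta : R) (lam : int -> R)
    : Prop :=
  exists (C : R) (N : nat), forall n : int, n != 0 -> (N <= `|n|)%N ->
    `|lam n - (pi * n%:~R / 2 - theta / 2)| <= C / `|n%:~R|.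

(* lam is the increasing enumeration of the spectrum by all the integers. *)
Definition dirac_eigenvalue_indexing {R : realType} (p r : R -> R)
    (alpha beta : R) (lam : int -> R) : Prop :=
  [/\ forall z : R[i],
        dirac_eigenvalue p r alpha beta z <-> exists n : int, z = (lam n)%:C,
      {homo lam : m n / m < n} &
      dirac_asymptotics (dirac_theta p r alpha beta) lam].

Definition K0 {R : realType} : R := 1 / Num.sqrt 2.

Definition Lambda0 {R : realType} (q : nat) (x : int -> R)
    (n : 'I_(q + q) -> int) : 'M[R]_(q + q) :=
  K0 *: row_mx (\matrix_(s < q + q, j < q) ((-1) ^ n s * x (n s) ^+ j))
               (\matrix_(s < q + q, j < q) - x (n s) ^+ j).

(* Main.v *)
Require Import Defs.
From mathcomp Require Import all_boot all_order all_algebra.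
From mathcomp Require Import all_classical all_reals all_analysis.
From mathcomp Require Import complex.

Import Order.TTheory GRing.Theory Num.Theory.
Local Open Scope ring_scope.

(** A column vector of height [2 q] is a pair of polynomials [A], [B] of degree
    less than [q], and row [s] of the matrix sends it to
    [(-1)^(n s) * A(x_s) - B(x_s)].  So the kernel consists of the pairs for
    which [A - B] vanishes at the nodes of even index and [A + B] at those of
    odd index ([signed_vandermonde_kernel]).  The pair [(A - B, A + B)] may be
    prescribed freely, since 2 is invertible, and the nodes are distinct.
    Hence the kernel is zero when each parity class has [q] nodes, a nonzero
    polynomial of degree less than [q] having fewer than [q] roots; whereas if
    one class has fewer than [q] nodes, the product of the linear factors at
    these nodes gives a nonzero element of the kernel.  As there are [2 q]
    nodes, one class is too small unless both have exactly [q] elements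
    ([signed_vandermonde_unit]).

    For the Dirac problem, the eigenvalues increase strictly with the index, so
    their inverses are distinct nodes. *)

Definition signed_vandermonde {F : fieldType} (q : nat) (odd_node : 'I_(q + q) -> bool)
    (x : 'I_(q + q) -> F) : 'M[F]_(q + q) :=
  row_mx (\matrix_(s < q + q, j < q) ((-1) ^+ odd_node s * x s ^+ j))
         (\matrix_(s < q + q, j < q) - x s ^+ j).

Lemma signed_vandermonde_kernel (F : fieldType) (q : nat)
    (odd_node : 'I_(q + q) -> bool) (x : 'I_(q + q) -> F) (a b : 'rV[F]_q) :
  row_mx a b *m (signed_vandermonde q odd_node x)^T = 0 <->
  forall s, (-1) ^+ odd_node s * (rVpoly a).[x s] = (rVpoly b).[x s].
Proof.
have entry s : (row_mx a b *m (signed_vandermonde q odd_node x)^T) 0 s =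
    (-1) ^+ odd_node s * (rVpoly a).[x s] - (rVpoly b).[x s].
  rewrite tr_row_mx mul_row_col !mxE.
  rewrite (horner_coef_wide _ (size_poly _ _)) mulr_sumr.
  congr (_ + _); first by apply: eq_bigr => j _; rewrite !mxE coef_rVpoly_ord mulrCA.
  rewrite (horner_coef_wide _ (size_poly _ _)) -sumrN.
  by apply: eq_bigr => j _; rewrite !mxE coef_rVpoly_ord mulrN.
split=> [/rowP ker s | ker].
  by apply/eqP; rewrite -subr_eq0 -entry ker mxE.
by apply/rowP => s; rewrite entry ker subrr mxE.
Qed.

Lemma poly_eq0_of_card_roots (F : fieldType) (T : finType) (x : T -> F)
    (E : {set T}) (f : {poly F}) :
  injective x -> {in E, forall s, f.[x s] = 0} -> (size f <= #|E|)%N -> f = 0.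
Proof.
move=> x_inj f_root size_f.
apply: (@roots_geq_poly_eq0 _ _ [seq x s | s <- enum E]).
- by apply/allP => _ /mapP[s sE ->]; apply/rootP/f_root; rewrite mem_enum in sE.
- by rewrite (map_inj_uniq x_inj) enum_uniq.
- by rewrite size_map -cardE.
Qed.

(** The witness is the product of the linear factors at the nodes in [E], whose
    degree [#|E|] is small enough for it to be read back from a row of length
    [q]. *)
Lemma exists_row_vanishing_on (F : fieldType) (q : nat) (T : finType) (x : T -> F)
    (E : {set T}) :
  (#|E| < q)%N ->
  exists2 a : 'rV[F]_q, a != 0 & {in E, forall s, (rVpoly a).[x s] = 0}.
Proof.
move=> ltEq; pose f := \prod_(s in E) ('X - (x s)%:P).
have size_f : size f = #|E|.+1.
  by rewrite /f -big_enum size_prod_XsubC -cardE.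
have fK : rVpoly (poly_rV f : 'rV_q) = f by rewrite poly_rV_K // size_f.
exists (poly_rV f).
  apply/eqP => f0; move: fK size_f.
  by rewrite f0 linear0 => <-; rewrite size_poly0.
move=> s sE; rewrite fK /f (bigD1 s) //= hornerM hornerXsubC subrr.
by rewrite mul0r.
Qed.

Lemma signed_vandermonde_unit (F : fieldType) (q : nat)
    (odd_node : 'I_(q + q) -> bool) (x : 'I_(q + q) -> F) :
  (2 : F) != 0 -> injective x ->
  signed_vandermonde q odd_node x \in unitmx <->
  #|[set s | ~~ odd_node s]| = q /\ #|[set s | odd_node s]| = q.
Proof.
move=> two_neq0 x_inj; set E := [set s | ~~ odd_node s]; set O := [set s | odd_node s].
rewrite -unitmx_tr -row_free_unit -kermx_eq0; split; last first.
  move=> [cardE cardO]; apply/rowV0P => v /sub_kermxP.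
  rewrite -[v]hsubmxK; set a := lsubmx v; set b := rsubmx v.
  move/signed_vandermonde_kernel => ker.
  have ab_eq : rVpoly a = rVpoly b.
    apply/eqP; rewrite -subr_eq0; apply/eqP.
    apply: (@poly_eq0_of_card_roots _ _ x E) => // [s|].
      rewrite inE => /negbTE even_s; rewrite hornerD hornerN -ker even_s.
      by rewrite mul1r subrr.
    by rewrite cardE -linearB size_poly.
  have ab_opp : rVpoly a + rVpoly b = 0.
    apply: (@poly_eq0_of_card_roots _ _ x O) => // [s|].
      rewrite inE => odd_s; rewrite hornerD -ker odd_s.
      by rewrite mulN1r subrr.
    by rewrite cardO -linearD size_poly.
  have b0 : b = 0.
    apply: (can_inj (@rVpolyK _ _)); rewrite linear0.
    move/eqP: ab_opp; rewrite ab_eq -mulr2n -scaler_nat scaler_eq0.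
    by rewrite (negbTE two_neq0) => /eqP.
  have a0 : a = 0 by apply: (can_inj (@rVpolyK _ _)); rewrite ab_eq b0.
  by rewrite a0 b0 row_mx0.
move=> /rowV0P ker0.
have trivial_ker (a b : 'rV_q) :
    (forall s, (-1) ^+ odd_node s * (rVpoly a).[x s] = (rVpoly b).[x s]) ->
    a = 0.
  move=> ker; have /sub_kermxP/ker0 ab0 := (signed_vandermonde_kernel _ _ _ _ a b).2 ker.
  by rewrite -[a](row_mxKl a b) ab0 linear0.
have leqE : (q <= #|E|)%N.
  (* Otherwise take [B = - A], with [A] vanishing at the even nodes. *)
  rewrite leqNgt; apply/negP => /(exists_row_vanishing_on _ _ _ x)[a a_neq0 a_root].
  case/eqP: a_neq0; apply: (trivial_ker a (- a)) => s.
  rewrite linearN hornerN; have [odd_s|even_s] := boolP (odd_node s).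
    by rewrite mulN1r.
  by rewrite a_root ?inE // mulr0 oppr0.
have leqO : (q <= #|O|)%N.
  (* Otherwise take [B = A], with [A] vanishing at the odd nodes. *)
  rewrite leqNgt; apply/negP => /(exists_row_vanishing_on _ _ _ x)[a a_neq0 a_root].
  case/eqP: a_neq0; apply: (trivial_ker a a) => s.
  have [odd_s|even_s] := boolP (odd_node s); last by rewrite mul1r.
  by rewrite a_root ?inE // mulr0.
have cardEO : (#|E| + #|O| = q + q)%N.
  rewrite -[RHS]card_ord -(cardsC O) addnC; congr (_ + _)%N.
  by apply: eq_card => s; rewrite !inE.
split; apply/eqP; rewrite eqn_leq ?leqE ?leqO andbT.
  by rewrite -(leq_add2r #|O|) cardEO leq_add2l.
by rewrite -(leq_add2l #|E|) cardEO leq_add2r.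
Qed.

Lemma exprN1z_parity (F : fieldType) (m : int) :
  (-1 : F) ^ m = (-1) ^+ ~~ (2 %| m)%Z.
Proof.
rewrite dvdzE dvdn2 negbK; case: m => k; first by rewrite -exprnP signr_odd.
by rewrite NegzE abszN -invr_expz -exprnP -[in LHS]signr_odd invr_sign.
Qed.

Theorem mainTheorem6 (R : realType) (q : nat) (hq : (1 <= q)%N)
    (p r : R -> R) (hp : class_C q p) (hr : class_C q r)
    (alpha beta : R) (halpha : 0 <= alpha <= pi) (hbeta : 0 <= beta <= pi)
    (h0 : ~ dirac_eigenvalue p r alpha beta 0)
    (lam : int -> R) (hlam : dirac_eigenvalue_indexing p r alpha beta lam)
    (n : 'I_(q + q) -> int) (hninj : injective n) (hn0 : forall s, n s != 0) :
  Lambda0 (fun m => 1 / lam m) n \in unitmx <->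
  #|[set s : 'I_(q + q) | (2 %| n s)%Z]| = q /\ #|[set s : 'I_(q + q) | ~~ (2 %| n s)%Z]| = q.
Proof.
have [spectrum lam_incr _] := hlam.
have lam_inj : injective lam by apply: inc_inj; apply: le_mono.
have x_inj : injective (fun s => 1 / lam (n s)).
  by move=> s t; rewrite !div1r => /invr_inj/lam_inj/hninj.
have -> : Lambda0 (fun m => 1 / lam m) n =
    K0 *: signed_vandermonde q (fun s => ~~ (2 %| n s)%Z) (fun s => 1 / lam (n s)).
  congr (_ *: row_mx _ _).
  by apply/matrixP => s j; rewrite !mxE exprN1z_parity.
have K0_unit : (K0 : R) \is a GRing.unit.
  by rewrite unitfE /K0 div1r invr_eq0 gt_eqF // sqrtr_gt0 ltr0n.
rewrite unitmxZ // signed_vandermonde_unit ?pnatr_eq0 //.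
suff -> : [set s | ~~ ~~ (2 %| n s)%Z] = [set s | (2 %| n s)%Z] by [].
by apply/setP => s; rewrite !inE negbK.
Qed.
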